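(* Assume $N:=-\lambda_1-\alpha_1\in\mathbb{Z}_{\ge0}$, $\beta<1$, $\alpha_2-\alpha_1<1$, $t_1>0$, $t_2>0$, $h_1<h_2$, $l_1<l_2$, and moreover $2N+1+h_2-l_2-\beta<0$ and $2N+l_1-l_2-\beta<0$. Let $c_n(E)$ be the polynomials in $E$ defined in the context. Let $k\in\{1,2,\dots,N+1\}$ and let $E_k=E_k(q)$ (defined for sufficiently small $q>0$) be a solution of $c_{N+1}(E)=0$ such that $E_k\sim -q^{k-3/2+\lambda_1+l_1+\alpha_1+\alpha_2}t_1$. (i) The coefficients of the normalized polynomial-type solution $x^{\lambda_1}\sum_{n=0}^N c_n(E_k)x^n$ of the $q$-Heun equation with $E=E_k$ satisfy $$c_n(E_k)\sim t_2^{-1}\,q^{2n-1/2-l_2-\beta}\,c_{n-1}(E_k)\quad(1\le n\le k-1),$$ $$c_n(E_k)\sim -t_1^{-1}\,q^{n-k+1/2-l_1}\,c_{n-1}(E_k)\quad(k\le n\le N).$$ (ii) As polynomials in $x$, $$\sum_{n=0}^N c_n(E_k)x^n\sim\prod_{j=1}^{k-1}\left(1+t_2^{-1}q^{2j-1/2-l_2-\beta}x\right)\prod_{j=k}^N\left(1-t_1^{-1}q^{j-k+1/2-l_1}x\right).$$ (iii) For each $j=1,2,\dots,N$ there exists $q_j\in\mathbb{R}_{>0}$ such that the polynomial $\sum_{n=0}^N c_n(E_k)x^n$ has a zero $x=x_j(q)$ for $0<q<q_j$ which is continuous in $q$ and satisfies $$\lim_{q\to+0}\frac{x_j(q)}{-t_2\,q^{-2j+1/2+l_2+\beta}}=1\quad(j=1,\dots,k-1),$$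 $$\lim_{q\to+0}\frac{x_j(q)}{t_1\,q^{k-j-1/2+l_1}}=1\quad(j=k,\dots,N).$$
   Context: The parameters $t_1,t_2,h_1,h_2,l_1,l_2,\alpha_1,\alpha_2,\beta$ are fixed real numbers independent of $q$, and $0<q<1$ is a variable. Set $\lambda_1=(h_1+h_2-l_1-l_2-\alpha_1-\alpha_2-\beta+2)/2$. The $q$-Heun equation with accessory parameter $E$ is $$(x-q^{h_1+1/2}t_1)(x-q^{h_2+1/2}t_2)\,g(x/q)+q^{\alpha_1+\alpha_2}(x-q^{l_1-1/2}t_1)(x-q^{l_2-1/2}t_2)\,g(qx)$$ $$-\{(q^{\alpha_1}+q^{\alpha_2})x^2+Ex+q^{(h_1+h_2+l_1+l_2+\alpha_1+\alpha_2)/2}(q^{\beta/2}+q^{-\beta/2})t_1t_2\}\,g(x)=0 .$$ The polynomials $c_n(E)$ are defined by $c_{-1}(E)=0$, $c_0(E)=1$ and, for $n=1,\dots,N+1$, $$c_n(E)\,t_1t_2q^{h_1+h_2}(1-q^n)(1-q^{n-\beta})=c_{n-1}(E)\Big[Eq^{n-1+\lambda_1}+q^{1/2}(q^{h_1}t_1+q^{h_2}t_2)+(q^{l_1}t_1+q^{l_2}t_2)q^{2(n-1+\lambda_1)+\alpha_1+\alpha_2-1/2}\Big]$$ $$-c_{n-2}(E)\,q\,(1-q^{n-2+\lambda_1+\alpha_1})(1-q^{n-2+\lambda_1+\alpha_2}).$$ If $c_{N+1}(E_k)=0$, then $x^{\lambda_1}\sum_{n=0}^N c_n(E_k)x^n$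 solves the $q$-Heun equation with $E=E_k$; ''normalized'' refers to $c_0(E_k)=1$. For functions of $q$: $a(q)\sim b(q)$ means $\lim_{q\to+0}a(q)/b(q)=1$. For polynomials in a variable with $q$-dependent coefficients, $\sim$ means that corresponding coefficients are equivalent in this sense. Empty products equal $1$. *)

(* Defs.v *)
From mathcomp Require Import all_boot all_order all_algebra.
From mathcomp Require Import all_classical all_reals all_analysis.
Set Implicit Arguments.
Unset Strict Implicit.
Unset Printing Implicit Defensive.
Import Order.TTheory GRing.Theory Num.Theory numFieldNormedType.Exports.
Local Open Scope classical_set_scope.
Local Open Scope ring_scope.

Record qheun_params (R : realType) := QHeunParams {
  t1 : R; t2 : R; h1 : R; h2 : R; l1 : R; l2 : R;
  alpha1 : R; alpha2 : R; beta : R }.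

Definition lambda1 (R : realType) (p : qheun_params R) : R :=
  (h1 p + h2 p - l1 p - l2 p - alpha1 p - alpha2 p - beta p + 2) / 2.

Definition qheun_eq (R : realType) (p : qheun_params R) (q E : R)
    (g : R -> R) (x : R) : Prop :=
  (x - q `^ (h1 p + 1 / 2) * t1 p) * (x - q `^ (h2 p + 1 / 2) * t2 p)
    * g (x / q)
  + q `^ (alpha1 p + alpha2 p)
    * (x - q `^ (l1 p - 1 / 2) * t1 p) * (x - q `^ (l2 p - 1 / 2) * t2 p)
    * g (q * x)
  - ((q `^ alpha1 p + q `^ alpha2 p) * x ^+ 2 + E * x
     + q `^ ((h1 p + h2 p + l1 p + l2 p + alpha1 p + alpha2 p) / 2)
       * (q `^ (beta p / 2) + q `^ (- (beta p / 2))) * t1 p * t2 p) * g x = 0.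

(* The factor of c_n in the three-term recurrence; it is nonzero when
   0 < q < 1, t1, t2 != 0, n >= 1 and beta < 1. *)
Definition qheun_den (R : realType) (p : qheun_params R) (q : R) (n : nat) : R :=
  t1 p * t2 p * q `^ (h1 p + h2 p) * (1 - q ^+ n) * (1 - q `^ (n%:R - beta p)).

(* The right-hand side of the recurrence for c_n, in terms of
   a = c_{n-2} and b = c_{n-1}; the indeterminate 'X is E. *)
Definition qheun_rhs (R : realType) (p : qheun_params R) (q : R) (n : nat)
    (a b : {poly R}) : {poly R} :=
  b * (q `^ (n%:R - 1 + lambda1 p) *: 'X
       + (q `^ (1 / 2) * (q `^ h1 p * t1 p + q `^ h2 p * t2 p)
          + (q `^ l1 p * t1 p + q `^ l2 p * t2 p)
            * q `^ (2 * (n%:R - 1 + lambda1 p)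
                    + alpha1 p + alpha2 p - 1 / 2))%:P)
  - (q * (1 - q `^ (n%:R - 2 + lambda1 p + alpha1 p))
       * (1 - q `^ (n%:R - 2 + lambda1 p + alpha2 p))) *: a.

(* The pair (c_{n-1}, c_n). *)
Fixpoint qheun_cpair (R : realType) (p : qheun_params R) (q : R) (n : nat)
    : {poly R} * {poly R} :=
  if n is m.+1 then
    let ab := qheun_cpair p q m in
    (ab.2, (qheun_den p q n)^-1 *: qheun_rhs p q n ab.1 ab.2)
  else (0, 1).

Definition qheun_c (R : realType) (p : qheun_params R) (q : R) (n : nat)
    : {poly R} := (qheun_cpair p q n).2.

Lemma qheun_c0 (R : realType) (p : qheun_params R) (q : R) : qheun_c p q 0 = 1.
Proof. by []. Qed.

Lemma qheun_c1E (R : realType) (p : qheun_params R) (q : R) :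
  qheun_den p q 1 != 0 ->
  qheun_den p q 1 *: qheun_c p q 1 = qheun_rhs p q 1 0 (qheun_c p q 0).
Proof. by move=> d0; rewrite /qheun_c /= scalerA mulfV// scale1r. Qed.

Lemma qheun_cE (R : realType) (p : qheun_params R) (q : R) (n : nat) :
  qheun_den p q n.+2 != 0 ->
  qheun_den p q n.+2 *: qheun_c p q n.+2 =
  qheun_rhs p q n.+2 (qheun_c p q n) (qheun_c p q n.+1).
Proof. by move=> d0; rewrite /qheun_c [in LHS]/= scalerA mulfV// scale1r. Qed.

Definition qheun_poly (R : realType) (p : qheun_params R) (N : nat) (q E : R)
    : {poly R} := \poly_(n < N.+1) (qheun_c p q n).[E].

(* Since y / 0 = 0, this forces b to be nonzero for small q > 0. *)
Definition equiv0 (R : realType) (a b : R -> R) : Prop :=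
  (fun q => a q / b q) @ 0^'+ --> (1 : R).

(* The degree bound d restricts the comparison to the coefficients of index
   at most d: above it both sides vanish and have no quotient. *)
Definition poly_equiv0 (R : realType) (d : nat) (P Q : R -> {poly R}) : Prop :=
  (\forall q \near 0^'+, (size (P q) <= d.+1)%N /\ (size (Q q) <= d.+1)%N) /\
  forall i : nat, (i <= d)%N -> equiv0 (fun q => (P q)`_i) (fun q => (Q q)`_i).

(* Main.v *)
Require Import Defs.
From mathcomp Require Import all_boot all_order all_algebra.
From mathcomp Require Import all_classical all_reals all_analysis.
From mathcomp Require Import ring lra zify.
Set Implicit Arguments.
Unset Strict Implicit.
Unset Printing Implicit Defensive.
Import Order.TTheory GRing.Theory Num.Theory numFieldNormedType.Exports.
Local Open Scope classical_set_scope.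
Local Open Scope ring_scope.

(** Write the recurrence as D_n c_n = b_n(E) c_(n-1) - a_n c_(n-2).  As q
    tends to 0+ every quantity in it is a constant times a power of q up to a
    factor 1 + o(1), so the problem is one about exponents.  Here D_n is of
    order q^(h1+h2), a_n of order q^(2n-1+h1+h2-l1-l2-beta), and b_n(E) is, up
    to negligible terms, t1 (A_n - s B_n) when E is s times the prescribed
    scale of E_k, with A_n = B_n at n = k, A_n dominant for n < k and B_n
    dominant for n > k.  The inequality involving h2 says that the summand
    q^(h1+1/2) t1 of b_n is negligible, the one involving l1 - l2 that a_n is.

    Run forward, the recurrence therefore gives c_n / c_(n-1) ~ b_n / D_n as
    long as b_n is not degenerate, that is for n < k when s = 1; for s <> 1 it
    goes through n = k and up to n = N+1 (c_asympt).  For n >= k and E = E_k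
    the cancellation at n = k makes the leading term of the forward recursion
    vanish, and the true solution is the recessive one: it is computed downward
    from c_(N+1) = 0, where the dominant balance is b_(n+1) c_n ~ a_(n+1) c_(n-1)
    (backward_step, backward_ratio).  Together these give part (i); the ratios
    c_n / c_(n-1) have strictly increasing exponents (ratio_exp_incr), so a
    product of the linear factors 1 + (c_n / c_(n-1)) x has coefficients
    equivalent to the c_n, which is part (ii).  That the sum
    solves the q-Heun equation is a telescoping identity, closed at the top by
    c_(N+1) = 0 and by lambda1 + alpha1 + N = 0 (three_term_telescope).

    For part (iii), a polynomial whose consecutive coefficient ratios have
    strictly increasing exponents changes sign across each point
    - c_(j-1) / c_j, because only the terms j-1 and j matter there, and
    these points are of different orders of magnitude (newton_value).  As many
    sign changes as the degree, in disjoint windows, leave exactly one root in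
    each window; such a root depends continuously on q as soon as the
    coefficients do (continuous_isolated_root, root_branch).  The coefficients
    involve E_k(q), about which only an asymptotic equivalence is assumed;
    its continuity comes from the same root-counting applied to c_(N+1), which
    changes sign across each of its N+1 root scales by c_asympt with s <> 1
    (eigen_sign, eigen_roots, continuous_eigenvalue). *)

(** * Monomial asymptotics at 0+ *)

(** f q = (C + o(1)) q^e, where C = 0 is allowed and then means f = o(q^e).  A
    Variant rather than a definition, so that unification and implicit
    arguments do not see the quantifiers inside the convergence statement. *)
Variant asympt (R : realType) (f : R -> R) (C e : R) : Prop :=
  Asympt of f q * q `^ (- e) @[q --> 0^'+] --> C.

Section Asympt.
Variable R : realType.
Implicit Types (f g : R -> R) (C e a : R).

Lemma near0_gt0 : \forall q \near (0 : R)^'+, 0 < q.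
Proof. exact: nbhs_right_gt. Qed.

Lemma near0_lt1 : \forall q \near (0 : R)^'+, 0 < q < 1.
Proof.
by near=> q; apply/andP; split; near: q; [exact: nbhs_right_gt|exact: nbhs_right_lt].
Unshelve. all: by end_near. Qed.

Lemma gt0_powRD q a e : 0 < q -> q `^ (a + e) = q `^ a * q `^ e.
Proof. by move=> q0; rewrite powRD // (lt0r_neq0 q0) implybT. Qed.

Lemma near0_cvg f g C :
  (\forall q \near 0^'+, f q = g q) -> f q @[q --> 0^'+] --> C ->
  g q @[q --> 0^'+] --> C.
Proof. by move=> fg; apply: cvg_trans; exact: near_eq_cvg. Qed.

Lemma asympt_near f g C e :
  (\forall q \near 0^'+, f q = g q) -> asympt f C e -> asympt g C e.
Proof.
move=> fg [fC]; constructor; apply: near0_cvg fC.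
by near=> q; congr (_ * _); near: q.
Unshelve. all: by end_near. Qed.

Lemma asympt0P f C : asympt f C 0 <-> f q @[q --> 0^'+] --> C.
Proof.
have E : (fun q => f q * q `^ (- 0)) = f.
  by apply/funext => q; rewrite oppr0 powRr0 mulr1.
by split=> [[]|fC]; [|constructor]; rewrite E.
Qed.

Lemma asympt_cst C : asympt (fun=> C) C 0.
Proof. apply/asympt0P; exact: cvg_cst. Qed.

Lemma asympt_powR a : asympt (fun q => q `^ a) 1 a.
Proof.
constructor; have : (fun=> (1 : R)) @ (0 : R)^'+ --> (1 : R) by exact: cvg_cst.
apply: near0_cvg; near=> q.
have q0 : 0 < q by near: q; exact: near0_gt0.
by rewrite -gt0_powRD // subrr powRr0.
Unshelve. all: by end_near. Qed.

Lemma asymptM f g C D e a :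
  asympt f C e -> asympt g D a -> asympt (fun q => f q * g q) (C * D) (e + a).
Proof.
move=> [fC] [gD]; constructor; apply: near0_cvg (cvgM fC gD).
near=> q; have q0 : 0 < q by near: q; exact: near0_gt0.
by rewrite /= opprD gt0_powRD //; ring.
Unshelve. all: by end_near. Qed.

Lemma asymptD f g C D e :
  asympt f C e -> asympt g D e -> asympt (fun q => f q + g q) (C + D) e.
Proof.
move=> [fC] [gD]; constructor; apply: near0_cvg (cvgD fC gD).
by near=> q; rewrite /= -mulrDl.
Unshelve. all: by end_near. Qed.

Lemma asymptZ f C e a : asympt f C e -> asympt (fun q => a * f q) (a * C) e.
Proof. by move=> fC; have := asymptM (asympt_cst a) fC; rewrite add0r. Qed.

Lemma asymptN f C e : asympt f C e -> asympt (fun q => - f q) (- C) e.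
Proof.
move=> /(asymptZ (- 1)); rewrite mulN1r; apply: asympt_near.
by apply: nearW => q; rewrite mulN1r.
Qed.

Lemma asymptB f g C D e :
  asympt f C e -> asympt g D e -> asympt (fun q => f q - g q) (C - D) e.
Proof. by move=> fC gD; apply: asymptD => //; apply: asymptN. Qed.

Lemma asymptV f C e :
  C != 0 -> asympt f C e -> asympt (fun q => (f q)^-1) C^-1 (- e).
Proof.
move=> C0 [fC]; constructor; apply: near0_cvg (cvgV C0 fC).
by near=> q; rewrite /= invfM -powRN.
Unshelve. all: by end_near. Qed.

(** Allowing C = 0 turns every comparison of exponents into an instance of
    asymptD: negligible terms are brought to the exponent of the dominant one. *)
Lemma asympt_o f C e a : a < e -> asympt f C e -> asympt f 0 a.
Proof.
move=> ae [fC]; have ea0 : 0 < e - a by rewrite subr_gt0.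
suff: asympt f (C * 0) a by rewrite mulr0.
constructor; apply: near0_cvg (cvgM fC (powR_cvg0 ea0)).
near=> q; have q0 : 0 < q by near: q; exact: near0_gt0.
by rewrite /= -mulrA -gt0_powRD // addrA addNr add0r.
Unshelve. all: by end_near. Qed.

Lemma asympt_eq f C D e a : C = D -> e = a -> asympt f C e -> asympt f D a.
Proof. by move=> -> ->. Qed.

Lemma asympt_gt0 f C e : 0 < C -> asympt f C e -> \forall q \near 0^'+, 0 < f q.
Proof.
move=> C0 [/cvgr_gt /(_ _ C0) fC]; near=> q.
have q0 : 0 < q by near: q; exact: near0_gt0.
have : 0 < f q * q `^ (- e) by near: q.
by rewrite pmulr_lgt0 // powR_gt0.
Unshelve. all: by end_near. Qed.

Lemma asympt_lt0 f C e : C < 0 -> asympt f C e -> \forall q \near 0^'+, f q < 0.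
Proof.
rewrite -oppr_gt0 => C0 /asymptN /(asympt_gt0 C0); apply: filterS => q.
by rewrite oppr_gt0.
Qed.

Lemma asympt_neq0 f C e :
  C != 0 -> asympt f C e -> \forall q \near 0^'+, f q != 0.
Proof.
rewrite neq_lt => /orP[] C0; last first.
  by move=> /(asympt_gt0 C0); apply: filterS => q /lt0r_neq0.
by move=> /(asympt_lt0 C0); apply: filterS => q /ltr0_neq0.
Qed.

Lemma asympt_equiv0 f g C e :
  C != 0 -> asympt f C e -> asympt g C e -> equiv0 f g.
Proof.
move=> C0 fC /(asymptV C0) gC; have := asymptM fC gC.
by rewrite mulfV // subrr => /asympt0P.
Qed.

Lemma equiv0_asympt f g C e :
  C != 0 -> equiv0 f g -> asympt g C e -> asympt f C e.
Proof.
move=> C0 fg gC; have fg' : asympt (fun q => f q / g q) 1 0 by apply/asympt0P.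
have := asymptM fg' gC; rewrite mul1r add0r; apply: asympt_near.
near=> q; rewrite mulfVK //; near: q; exact: asympt_neq0 gC.
Unshelve. all: by end_near. Qed.

Lemma asympt_exp f C e n :
  asympt f C e -> asympt (fun q => f q ^+ n) (C ^+ n) (n%:R * e).
Proof.
move=> fC; elim: n => [|n IH].
  by rewrite mul0r; exact: asympt_cst.
rewrite exprS -natr1 mulrDl mul1r addrC; apply: asympt_near (asymptM fC IH).
by apply: nearW => q; rewrite exprS.
Qed.

Lemma asympt_sum (I : Type) (r : seq I) (P : pred I) (f : I -> R -> R)
    (C : I -> R) e :
  (forall i, P i -> asympt (f i) (C i) e) ->
  asympt (fun q => \sum_(i <- r | P i) f i q) (\sum_(i <- r | P i) C i) e.
Proof.
move=> fC; constructor; under eq_fun do rewrite mulr_suml.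
have {}fC i : P i -> f i q * q `^ (- e) @[q --> 0^'+] --> C i by move=> /fC[].
by apply: cvg_big => //; exact: add_continuous.
Qed.

End Asympt.

(** * Isolated roots of a polynomial depending on a parameter *)

Section Near0.
Variable R : realType.

Lemma near0_forall (M : nat) (P : nat -> R -> Prop) :
  (forall i, (i < M)%N -> \forall q \near 0^'+, P i q) ->
  \forall q \near 0^'+, forall i, (i < M)%N -> P i q.
Proof.
elim: M => [|M IH] HP; first by apply: nearW.
have HM := HP M (ltnSn M).
have {}IH := IH (fun i iM => HP i (ltnW iM)).
near=> q => i; rewrite ltnS leq_eqVlt => /orP[/eqP ->|].
  by near: q.
by move: i; near: q.
Unshelve. all: by end_near. Qed.

Lemma near0_exists (P : R -> Prop) : (\forall q \near 0^'+, P q) ->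
  exists2 q0, 0 < q0 & forall q, 0 < q < q0 -> P q.
Proof.
move=> /nbhs_ballP[e /= e0 He]; exists e => // q /andP[q0 qe]; apply: He => //.
by rewrite /ball /= sub0r normrN gtr0_norm.
Qed.

Lemma near_itv (a b q : R) : a < q < b -> \forall x \near q, a < x < b.
Proof.
move=> /andP[aq qb]; near=> x; apply/andP; split; near: x.
  exact: lt_nbhsr.
exact: lt_nbhsl.
Unshelve. all: by end_near. Qed.

End Near0.

Section Roots.
Variable R : realType.
Implicit Types (P : {poly R}) (a b : R).

Lemma poly_root_between P a b : a < b -> P.[a] * P.[b] < 0 ->
  exists2 x, a < x < b & root P x.
Proof.
move=> ab Pab.
have [x /andP[ax xb] Px] : exists2 x, a <= x <= b & root P x.
  have [Pa|Pa|Pa] := ltgtP P.[a] 0.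
  - apply: poly_ivt; first exact: ltW.
    by rewrite (ltW Pa) /= ltW // -(nmulr_rlt0 _ Pa).
  - have [||x xab Px] := @poly_ivt R (- P) a b; first exact: ltW.
      rewrite !hornerN oppr_le0 oppr_ge0 (ltW Pa) /= ltW //.
      by rewrite -(pmulr_rlt0 _ Pa).
    by exists x => //; rewrite -rootN.
  - by move: Pab; rewrite Pa mul0r ltxx.
exists x => //; rewrite !lt_neqAle ax xb !andbT; apply/andP; split.
  by apply: contraTneq Pab => ->; rewrite (rootP Px) mul0r ltxx.
by apply: contraTneq Pab => <-; rewrite (rootP Px) mulr0 ltxx.
Qed.

(** Uniqueness in ]a, b[ together with the sign change forces a sign change
    across every smaller interval around s q0; the latter is an open condition
    in q, so nearby roots are trapped in arbitrarily small intervals. *)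
Lemma continuous_isolated_root (G : R -> {poly R}) (s : R -> R) a b (q0 : R) :
  (\forall q \near q0, [/\ a < s q < b, root (G q) (s q) &
     forall x, a < x < b -> root (G q) x -> x = s q]) ->
  (G q0).[a] * (G q0).[b] < 0 ->
  (forall x, {for q0, continuous (fun q => (G q).[x])}) ->
  {for q0, continuous s}.
Proof.
move=> Hs Gab Gcont; have [/andP[a_s s_b] rs uniq_s] := nbhs_singleton Hs.
have Ga0 : (G q0).[a] != 0.
  by apply: contraTneq Gab => ->; rewrite mul0r ltxx.
have Gb0 : (G q0).[b] != 0.
  by apply: contraTneq Gab => ->; rewrite mulr0 ltxx.
have left_sign u : a < u -> u < s q0 -> 0 < (G q0).[a] * (G q0).[u].
  move=> au us; have ub := lt_trans us s_b; rewrite ltNge le_eqVlt negb_or.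
  apply/andP; split.
    rewrite mulf_neq0 //; apply: contraTneq us => /rootP.
    by move=> /(uniq_s u); rewrite au ub => /(_ isT) ->; rewrite ltxx.
  apply/negP => /(poly_root_between au)[x /andP[ax xu]].
  move=> /(uniq_s x); rewrite ax (lt_trans xu ub) => /(_ isT) xs.
  by move: (lt_trans xu us); rewrite xs ltxx.
have right_sign v : s q0 < v -> v < b -> 0 < (G q0).[v] * (G q0).[b].
  move=> sv vb; have av := lt_trans a_s sv; rewrite ltNge le_eqVlt negb_or.
  apply/andP; split.
    rewrite mulf_neq0 //; apply: contraTneq sv => /rootP.
    by move=> /(uniq_s v); rewrite av vb => /(_ isT) ->; rewrite ltxx.
  apply/negP => /(poly_root_between vb)[x /andP[vx xb]].
  move=> /(uniq_s x); rewrite xb (lt_trans av vx) => /(_ isT) xs.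
  by move: (lt_trans sv vx); rewrite xs ltxx.
apply/cvgrPdist_lt => e e0.
pose u := Num.max ((a + s q0) / 2) (s q0 - e / 2).
pose v := Num.min ((s q0 + b) / 2) (s q0 + e / 2).
have au : a < u by rewrite lt_max; apply/orP; left; lra.
have us : u < s q0 by rewrite gt_max; apply/andP; split; lra.
have ue : s q0 - e < u by rewrite lt_max; apply/orP; right; lra.
have sv : s q0 < v by rewrite lt_min; apply/andP; split; lra.
have vb : v < b by rewrite gt_min; apply/orP; left; lra.
have ve : v < s q0 + e by rewrite gt_min; apply/orP; right; lra.
have Guv : (G q0).[u] * (G q0).[v] < 0.
  have := mulr_gt0 (left_sign _ au us) (right_sign _ sv vb).
  have -> : (G q0).[a] * (G q0).[u] * ((G q0).[v] * (G q0).[b]) =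
    ((G q0).[a] * (G q0).[b]) * ((G q0).[u] * (G q0).[v]) by ring.
  by rewrite nmulr_rgt0.
have : \forall q \near q0, (G q).[u] * (G q).[v] < 0.
  by apply: (cvgr_lt _ (cvgM (Gcont u) (Gcont v))).
move=> Guv'; near=> q.
have [/andP[asq sqb] rsq uniq_q] : [/\ a < s q < b, root (G q) (s q) &
     forall x, a < x < b -> root (G q) x -> x = s q] by near: q.
have [|x /andP[ux xv] rx] := @poly_root_between (G q) u v (lt_trans us sv).
  by near: q.
have xs : x = s q by apply: uniq_q => //; rewrite (lt_trans au ux) (lt_trans xv vb).
by rewrite -xs ltr_distl; apply/andP; split; lra.
Unshelve. all: by end_near. Qed.

(** Each of the M pairwise disjoint windows contains a root, so a second root
    in one of them would give M+1 roots to a polynomial of degree at most M.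
    The factor 3 between the scales is the ratio of the endpoints 1/2 and 3/2. *)
Lemma separated_roots_unique (M : nat) P (w : nat -> R) :
  (size P <= M.+1)%N ->
  (forall i, (i < M)%N -> P.[w i * (1 / 2)] * P.[w i * (3 / 2)] < 0) ->
  (forall i j, (i < M)%N -> (j < M)%N -> i != j ->
     `|w i| * 3 < `|w j| \/ `|w j| * 3 < `|w i|) ->
  forall j, (j < M)%N -> forall x y, 1 / 2 < x < 3 / 2 -> 1 / 2 < y < 3 / 2 ->
  root P (w j * x) -> root P (w j * y) -> x = y.
Proof.
move=> sizeP signP sep j jM x y xI yI rx ry; apply/eqP/negPn/negP => xy.
have P0 : P != 0.
  by apply/eqP => P0; move: (signP j jM); rewrite P0 !horner0 mulr0 ltxx.
have w0 : w j != 0.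
  apply/eqP => w0; move: (signP j jM); rewrite w0 !mul0r -expr2.
  by rewrite ltNge sqr_ge0.
have disj i k s t : (i < M)%N -> (k < M)%N -> 1 / 2 < s < 3 / 2 ->
    1 / 2 < t < 3 / 2 -> w i * s = w k * t -> i = k.
  move=> iM kM /andP[s1 s2] /andP[t1 t2] st; apply/eqP/negPn/negP => ik.
  have st' : `|w i| * s = `|w k| * t.
    have s0 : 0 < s by lra.
    have t0 : 0 < t by lra.
    by rewrite -{1}(gtr0_norm s0) -{1}(gtr0_norm t0) -!normrM st.
  have := normr_ge0 (w i); have := normr_ge0 (w k).
  by case: (sep _ _ iM kM ik) => ?; nra.
(* The clause (i < M)%N sits inside the existential, which makes a total
   choice function available. *)
have choose_root i : exists s, (i < M)%N ->
    1 / 2 < s < 3 / 2 /\ root P (w i * s).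
  have [iM|_] := ltnP i M; last by exists 0.
  have := @poly_root_between (P \Po (w i *: 'X)) (1 / 2) (3 / 2).
  rewrite !horner_comp !hornerZ !hornerX => /(_ _ (signP i iM)).
  case=> [|s sI]; first by lra.
  by rewrite /root horner_comp hornerZ hornerX => rs; exists s.
have [r rP] := choice choose_root.
pose root_of i := w i * (if i == j then y else r i).
have root_ofP i : (i < M)%N -> exists2 s, 1 / 2 < s < 3 / 2 &
    root_of i = w i * s /\ root P (w i * s).
  move=> iM; rewrite /root_of; case: eqP => [->|_]; first by exists y.
  by have [rI rr] := rP i iM; exists (r i).
pose rs := w j * x :: [seq root_of i | i <- iota 0 M].
have all_rs : all (root P) rs.
  rewrite /= rx; apply/allP => z /mapP[i]; rewrite mem_iota => iM ->.
  by have [s _ [-> ]] := root_ofP i iM.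
have uniq_rs : uniq rs.
  rewrite /=; apply/andP; split; last first.
    rewrite map_inj_in_uniq ?iota_uniq // => i k; rewrite !mem_iota /=.
    move=> iM kM; have [s sI [-> _]] := root_ofP i iM.
    by have [t tI [-> _]] := root_ofP k kM; apply: disj.
  apply/mapP => -[i]; rewrite mem_iota /= => iM xi.
  have ji : j = i.
    by have [s sI [si _]] := root_ofP i iM; apply: (disj _ _ x s); rewrite -?si.
  move: xi; rewrite /root_of -ji eqxx => /(mulfI w0) /eqP.
  by rewrite (negbTE xy).
have := max_poly_roots P0 all_rs uniq_rs.
by rewrite /= size_map size_iota ltnNge sizeP.
Qed.

Section Branch.
Variables (M : nat) (F : R -> {poly R}) (w : nat -> R -> R).
Hypothesis sizeF : \forall q \near 0^'+, (size (F q) <= M.+1)%N.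
Hypothesis sepw : forall i j, (i < M)%N -> (j < M)%N -> i != j ->
  \forall q \near 0^'+, `|w i q| * 3 < `|w j q| \/ `|w j q| * 3 < `|w i q|.
Hypothesis signF : forall j s t, (j < M)%N -> 0 < s < 1 -> 1 < t ->
  \forall q \near 0^'+, (F q).[w j q * s] * (F q).[w j q * t] < 0.
Hypothesis contF : forall j, (j < M)%N ->
  \forall q \near 0^'+, forall x, {for q, continuous (fun q => (F q).[w j q * x])}.

(** The last clause identifies any root function with the right asymptotics,
    even one not known to be continuous, with the branch s. *)
Lemma root_branch j : (j < M)%N -> exists (q0 : R) (s : R -> R),
  [/\ 0 < q0,
      forall q, 0 < q < q0 ->
        root (F q) (w j q * s q) /\ {for q, continuous s},
      s q @[q --> 0^'+] --> (1 : R) &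
      forall y : R -> R, (\forall q \near 0^'+, root (F q) (y q)) ->
        equiv0 y (w j) -> \forall q \near 0^'+, y q = w j q * s q].
Proof.
move=> jM.
have Fw q x : ((F q) \Po (w j q *: 'X)).[x] = (F q).[w j q * x].
  by rewrite horner_comp hornerZ hornerX.
have rootFw q x : root ((F q) \Po (w j q *: 'X)) x = root (F q) (w j q * x).
  by rewrite /root Fw.
have sign_w i : (i < M)%N ->
    \forall q \near 0^'+, (F q).[w i q * (1 / 2)] * (F q).[w i q * (3 / 2)] < 0.
  by move=> iM; apply: signF => //; lra.
have sep_near : \forall q \near 0^'+, forall i, (i < M)%N -> forall k, (k < M)%N ->
    i != k -> `|w i q| * 3 < `|w k q| \/ `|w k q| * 3 < `|w i q|.
  apply: near0_forall => i iM; apply: near0_forall => k kM.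
  have [_|ik] := boolP (i == k); first by apply: nearW.
  by apply: filterS (sepw iM kM ik).
pose s q := xget 1 [set x | 1 / 2 < x < 3 / 2 /\ root (F q) (w j q * x)].
have branch : \forall q \near 0^'+, [/\ 1 / 2 < s q < 3 / 2,
    root (F q) (w j q * s q),
    forall x, 1 / 2 < x < 3 / 2 -> root (F q) (w j q * x) -> x = s q &
    (F q).[w j q * (1 / 2)] * (F q).[w j q * (3 / 2)] < 0].
  near=> q.
  have signq : forall i, (i < M)%N ->
      (F q).[w i q * (1 / 2)] * (F q).[w i q * (3 / 2)] < 0.
    by near: q; apply: near0_forall.
  have sizeq : (size (F q) <= M.+1)%N by near: q.
  have sepq i k : (i < M)%N -> (k < M)%N -> i != k ->
      `|w i q| * 3 < `|w k q| \/ `|w k q| * 3 < `|w i q|.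
    by move=> iM kM; move: k kM; move: i iM; near: q.
  have uniqq := separated_roots_unique (w := w ^~ q) sizeq signq sepq jM.
  have [||x xI rx] := @poly_root_between ((F q) \Po (w j q *: 'X)) (1 / 2) (3 / 2).
  - lra.
  - by rewrite !Fw signq.
  have [sI rs] : [set x | 1 / 2 < x < 3 / 2 /\ root (F q) (w j q * x)] (s q).
    by apply: (xgetPex 1); exists x; split=> //; rewrite -rootFw.
  split=> //; last exact: signq.
  by move=> z zI rz; apply: uniqq.
(* Sign changes across arbitrarily narrow windows around 1 give roots there,
   which are s q by uniqueness in the window of radius 1/2. *)
have s1 : s q @[q --> 0^'+] --> (1 : R).
  apply/cvgrPdist_lt => e e0; pose d := Num.min e (1 / 2).
  have d0 : 0 < d by rewrite lt_min e0; lra.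
  have de : d <= e by rewrite ge_min lexx.
  have d2 : d <= 1 / 2 by rewrite ge_min lexx orbT.
  have signd : \forall q \near 0^'+,
      (F q).[w j q * (1 - d)] * (F q).[w j q * (1 + d)] < 0.
    by apply: signF => //; lra.
  near=> q.
  have [sI rs uniqs _] : [/\ 1 / 2 < s q < 3 / 2, root (F q) (w j q * s q),
    forall x, 1 / 2 < x < 3 / 2 -> root (F q) (w j q * x) -> x = s q &
    (F q).[w j q * (1 / 2)] * (F q).[w j q * (3 / 2)] < 0] by near: q.
  have [||x /andP[x1 x2] rx] :=
      @poly_root_between ((F q) \Po (w j q *: 'X)) (1 - d) (1 + d).
  - lra.
  - by rewrite !Fw; near: q.
  rewrite -(uniqs x) -?rootFw //; last by apply/andP; split; lra.
  by rewrite ltr_distl; apply/andP; split; lra.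
have [q1 q10 Hq1] := near0_exists branch.
have [q2 q20 Hq2] := near0_exists (contF jM).
exists (Num.min q1 q2), s; split=> //.
- by rewrite lt_min q10.
- move=> q; rewrite lt_min => /andP[q0 /andP[qq1 qq2]].
  have qI1 : 0 < q < q1 by rewrite q0.
  have qI2 : 0 < q < q2 by rewrite q0.
  have [sI rs uniqs sgn] := Hq1 q qI1; split=> //.
  apply: (@continuous_isolated_root
    (fun q => (F q) \Po (w j q *: 'X)) s (1 / 2) (3 / 2)).
  + near=> r; have [|? rr uniqr _] := Hq1 r; first by near: r; exact: near_itv.
    by split; rewrite ?rootFw // => x xI; rewrite rootFw; exact: uniqr.
  + by rewrite !Fw.
  + move=> x; have := Hq2 q qI2 x.
    by congr (continuous_at _ _); apply/funext => r; rewrite Fw.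
- move=> y ry yw; near=> q.
  have [sI rs uniqs sgn] : [/\ 1 / 2 < s q < 3 / 2, root (F q) (w j q * s q),
    forall x, 1 / 2 < x < 3 / 2 -> root (F q) (w j q * x) -> x = s q &
    (F q).[w j q * (1 / 2)] * (F q).[w j q * (3 / 2)] < 0] by near: q.
  have w0 : w j q != 0.
    apply/eqP => w0; move: sgn; rewrite w0 !mul0r -expr2.
    by rewrite ltNge sqr_ge0.
  have yE : y q = w j q * (y q / w j q) by rewrite mulrC divfK.
  rewrite {1}yE; congr (_ * _); apply: uniqs; last by rewrite -yE; near: q.
  apply/andP; split; near: q.
    by apply: (cvgr_gt _ yw); lra.
  by apply: (cvgr_lt _ yw); lra.
Unshelve. all: by end_near. Qed.

End Branch.


End Roots.

(** * Polynomials with a strictly convex Newton polygon *)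

Section Scales.
Variable R : realType.
Implicit Types (a b e q : R).

Lemma continuous_powR e q : 0 < q -> {for q, continuous (fun r => r `^ e)}.
Proof.
move=> q0; apply: differentiable_continuous; apply/derivable1_diffP.
by apply: derivable_powR; rewrite in_itv /= q0.
Qed.

Lemma monomial_asympt a e : asympt (fun q => a * q `^ e) a e.
Proof. by have := asymptZ a (asympt_powR e); rewrite mulr1. Qed.

Lemma monomial_separated a b e e' : a != 0 -> e < e' ->
  \forall q \near 0^'+, `|b * q `^ e'| * 3 < `|a * q `^ e|.
Proof.
move=> a0 ee'.
have a'0 : 0 < `|a| - 3 * 0 by rewrite mulr0 subr0 normr_gt0.
have := asympt_gt0 a'0 (asymptB (monomial_asympt `|a| e)
  (asymptZ 3 (asympt_o ee' (monomial_asympt `|b| e')))).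
apply: filterS => q; rewrite subr_gt0 mulrC.
by rewrite !normrM !(ger0_norm (powR_ge0 _ _)) mulrC.
Qed.

End Scales.

Lemma size_prod_linear (R : realType) (a : nat -> R) m :
  (size (\prod_(i < m) (1 + a i *: 'X) : {poly R})%R <= m.+1)%N.
Proof.
elim: m => [|m IH]; first by rewrite big_ord0 size_poly1.
have size2 : (size (1 + a m *: 'X : {poly R})%R <= 2)%N.
  apply: leq_trans (size_polyD _ _) _; rewrite geq_max size_poly1 /=.
  by apply: leq_trans (size_scale_leq _ _) _; rewrite size_polyX.
rewrite big_ord_recr /=; apply: leq_trans (size_polyMleq _ _) _.
by move: IH size2; move: (size _) (size _) => u v; lia.
Qed.

Section Newton.
Variables (R : realType) (N : nat) (C e : nat -> R).
Hypothesis C_neq0 : forall i, (i < N)%N -> C i != 0.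
Hypothesis e_incr : forall i j, (i < j < N)%N -> e i < e j.

Let K n := \prod_(i < n) C i.
Let X n := \sum_(i < n) e i.

Lemma leading_neq0 n : (n <= N)%N -> K n != 0.
Proof.
by move=> nN; apply/prodf_neq0 => i _; apply: C_neq0; apply: leq_trans nN.
Qed.

(** Of the products of n distinct ratios, the one of the first n has the
    smallest exponent. *)
Lemma newton_product_coef n : (n <= N)%N ->
  asympt (fun q => (\prod_(i < N) (1 + (C i * q `^ e i) *: 'X))`_n) (K n) (X n).
Proof.
suff H m : (m <= N)%N -> forall n, (n <= m)%N ->
    asympt (fun q => (\prod_(i < m) (1 + (C i * q `^ e i) *: 'X))`_n) (K n) (X n).
  exact: H.
elim: m => [_ [_|//]|m IH mN {}n nm].
  rewrite /K /X !big_ord0; apply: asympt_near (asympt_cst 1).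
  by apply: nearW => q; rewrite big_ord0 coef1.
have {}IH := IH (ltnW mN).
have coefE q : (\prod_(i < m.+1) (1 + (C i * q `^ e i) *: 'X))`_n =
    (\prod_(i < m) (1 + (C i * q `^ e i) *: 'X))`_n +
    C m * q `^ e m * (\prod_(i < m) (1 + (C i * q `^ e i) *: 'X))`_n.-1 *+ (n != 0%N).
  rewrite big_ord_recr /= mulrDr mulr1 coefD -scalerAr coefZ coefMX.
  by case: n {nm} => [|n] /=; rewrite ?mulr0.
apply: (asympt_near (f := fun q => (\prod_(i < m) (1 + (C i * q `^ e i) *: 'X))`_n +
    C m * q `^ e m * (\prod_(i < m) (1 + (C i * q `^ e i) *: 'X))`_n.-1 *+ (n != 0%N))).
  by apply: nearW => q; rewrite coefE.
case: n nm {coefE} => [_|n nm] /=.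
  by under eq_fun do rewrite mulr0n addr0; apply: IH.
under eq_fun do rewrite mulr1n.
have nm' : (n <= m)%N by [].
have Hn := asymptM (monomial_asympt (C m) (e m)) (IH n nm').
move: nm; rewrite ltnS leq_eqVlt => /orP[/eqP nm|nm].
  have <- : C n * K n = K n.+1 by rewrite /K big_ord_recr /= mulrC.
  have <- : e n + X n = X n.+1 by rewrite /X big_ord_recr /= addrC.
  subst m; apply: asympt_near Hn; apply: nearW => q.
  by rewrite [X in X + _]nth_default ?add0r //; exact: (size_prod_linear (fun i => C i * q `^ e i)).
have := asymptD (IH n.+1 nm) (asympt_o _ Hn); rewrite addr0; apply.
rewrite /X big_ord_recr /= addrC ltrD2r e_incr //.
by rewrite nm.
Qed.

(** X j - j * e j is the exponent of the j-th term at a point of order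
    q^(- e j); as n grows the exponent of the n-th term there varies with
    increment e n - e j, negative for n < j and positive for n > j. *)
Lemma newton_dominant j n : (j < N)%N -> (n <= N)%N -> n != j -> n != j.+1 ->
  X j - j%:R * e j < X n - n%:R * e j.
Proof.
move=> jN nN nj nj1.
have X1 m : X m.+1 - m.+1%:R * e j = (X m - m%:R * e j) + (e m - e j).
  by rewrite /X big_ord_recr /= -natr1; ring.
move: nj; rewrite neq_ltn => /orP[{nj1} nj|].
  suff H m : (n < m)%N -> (m <= j)%N -> X m - m%:R * e j < X n - n%:R * e j.
    exact: H.
  elim: m => // m IH; rewrite ltnS leq_eqVlt => /orP[/eqP <-|nm] mj; rewrite X1.
    by rewrite gtrDl subr_lt0 e_incr // mj.
  by apply: lt_trans (IH nm (ltnW mj)); rewrite gtrDl subr_lt0 e_incr // mj.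
rewrite leq_eqVlt eq_sym (negbTE nj1) /=.
have -> : X j - j%:R * e j = X j.+1 - j.+1%:R * e j by rewrite X1 subrr addr0.
elim: n nN {nj1} => // n IH nN; rewrite ltnS leq_eqVlt (X1 n) => /orP[/eqP jn|jn].
  by rewrite -jn in nN *; rewrite ltrDl subr_gt0 e_incr // ltnSn.
apply: lt_trans (IH (ltnW nN) jn) _.
by rewrite ltrDl subr_gt0 e_incr // (ltnW jn).
Qed.

Variable f : nat -> R -> R.
Hypothesis f_lead : forall n, (n <= N)%N -> asympt (f n) (K n) (X n).
Hypothesis f_cont : \forall q \near 0^'+,
  forall n, (n <= N)%N -> {for q, continuous (f n)}.

Let F q := \poly_(n < N.+1) f n q.
Let w j q := - (C j)^-1 * q `^ (- e j).

(** At s times the predicted root only the terms j and j+1 survive, and they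
    cancel exactly for s = 1. *)
Lemma newton_value j s : (j < N)%N ->
  asympt (fun q => (F q).[w j q * s])
    (K j * (- (C j)^-1 * s) ^+ j * (1 - s)) (X j - j%:R * e j).
Proof.
move=> jN; pose v := - (C j)^-1 * s.
pose L n := if (n == j) || (n == j.+1) then K n * v ^+ n else 0.
have -> : K j * (- (C j)^-1 * s) ^+ j * (1 - s) = \sum_(n < N.+1) L n.
  have jN1 : (j < N.+1)%N by exact: ltnW.
  rewrite (bigD1 (Ordinal jN1)) //=.
  rewrite (bigD1 (Ordinal (jN : (j.+1 < N.+1)%N))) /=; last first.
    by rewrite -val_eqE /= gtn_eqF.
  rewrite big1 => [|n /andP[n1 n2]]; last first.
    by rewrite /L -!val_eqE /= in n1 n2 *; rewrite (negbTE n1) (negbTE n2).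
  rewrite /L !eqxx orbT /= addr0 /K big_ord_recr /= exprS -/v.
  rewrite /v; field; exact: C_neq0.
have term n : (n <= N)%N ->
    asympt (fun q => f n q * (w j q * s) ^+ n) (L n) (X j - j%:R * e j).
  move=> nN.
  have ws : asympt (fun q => w j q * s) v (- e j).
    have := monomial_asympt v (- e j); apply: asympt_near.
    by apply: nearW => q; rewrite /v /w; ring.
  have := asymptM (f_lead nN) (asympt_exp n ws); rewrite mulrN /L.
  case: eqP => [->//|/eqP nj] /=; case: eqP => [->|/eqP nj1] /=; last first.
    by apply: asympt_o; apply: newton_dominant.
  by apply: asympt_eq => //; rewrite /X big_ord_recr /= -natr1; ring.
have sum_lead := @asympt_sum R 'I_N.+1 (index_enum _) xpredT
  (fun n q => f n q * (w j q * s) ^+ n) L _ (fun n _ => term n (leq_ord n)).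
apply: asympt_near sum_lead.
by apply: nearW => q; rewrite /F horner_poly.
Qed.

Lemma newton_roots j : (j < N)%N -> exists (q0 : R) (x : R -> R),
  [/\ 0 < q0,
      forall q, 0 < q < q0 -> root (F q) (x q) /\ {for q, continuous x} &
      equiv0 x (w j)].
Proof.
move=> jN.
have w0 i : (i < N)%N -> - (C i)^-1 != 0 by move=> iN; rewrite oppr_eq0 invr_eq0 C_neq0.
have [||||q0 [s [q00 Hs s1 _]]] := @root_branch R N F w _ _ _ _ j jN.
- by apply: nearW => q; exact: size_poly.
- move=> i k iN kN ik.
  case: (ltngtP i k) ik => // ik _.
    near=> q; left; near: q; apply: monomial_separated; first exact: w0.
    by rewrite ltrN2 e_incr // ik.
  near=> q; right; near: q; apply: monomial_separated; first exact: w0.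
  by rewrite ltrN2 e_incr // ik.
- move=> i s t iN /andP[s0 s1] t1.
  have t0 : 0 < t by apply: lt_trans t1.
  have := asymptM (newton_value s iN) (newton_value t iN); apply: asympt_lt0.
  rewrite !exprMn.
  have -> : K i * ((- (C i)^-1) ^+ i * s ^+ i) * (1 - s) *
     (K i * ((- (C i)^-1) ^+ i * t ^+ i) * (1 - t)) =
     - ((K i * (- (C i)^-1) ^+ i) ^+ 2 * (s ^+ i * t ^+ i * ((1 - s) * (t - 1)))) by ring.
  rewrite oppr_lt0 mulr_gt0 //.
    by rewrite exprn_even_gt0 //= mulf_neq0 ?expf_neq0 ?w0 // leading_neq0 // ltnW.
  by rewrite !mulr_gt0 ?exprn_gt0 ?subr_gt0.
- move=> i iN; near=> q => x.
  have q0 : 0 < q by near: q; exact: near0_gt0.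
  have fq : forall n, (n <= N)%N -> {for q, continuous (f n)} by near: q.
  have -> : (fun q => (F q).[w i q * x]) =
      (fun q => \sum_(n < N.+1) f n q * (w i q * x) ^+ n).
    by apply/funext => r; rewrite /F horner_poly.
  apply: cvg_big => [|n _]; first exact: add_continuous.
  apply: cvgM; first by apply: fq; exact: leq_ord.
  apply: (@cvg_comp _ _ _ (fun q => w i q * x) (fun y => y ^+ n));
    last exact: exprn_continuous.
  by apply: cvgMr_tmp; apply: cvgMl_tmp; exact: continuous_powR.
exists q0, (fun q => w j q * s q); split=> // [q qI|].
  have [rs cs] := Hs q qI; split=> //.
  apply: cvgM cs; apply: cvgMl_tmp; apply: continuous_powR.
  by case/andP: qI.
have s1' : asympt s 1 0 by apply/asympt0P.
apply: (asympt_equiv0 (w0 _ jN)) (monomial_asympt _ _).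
by have := asymptM (monomial_asympt (- (C j)^-1) (- e j)) s1'; rewrite mulr1 addr0.
Unshelve. all: by end_near. Qed.

End Newton.

(** * Asymptotics of the recurrence *)

Section Recurrence.
Variables (R : realType) (p : qheun_params R).
Implicit Types (q x : R) (n : nat).

(** The recurrence reads D_n c_n = b_n c_(n-1) - a_n c_(n-2), where D_n is
    qheun_den; this is b_n at E = x. *)
Definition mid_coef q n x : R :=
  x * q `^ (n%:R - 1 + lambda1 p)
  + (q `^ (1 / 2) * (q `^ h1 p * t1 p + q `^ h2 p * t2 p)
     + (q `^ l1 p * t1 p + q `^ l2 p * t2 p)
       * q `^ (2 * (n%:R - 1 + lambda1 p) + alpha1 p + alpha2 p - 1 / 2)).

(** The coefficient a_n of c_(n-2). *)
Definition low_coef q n : R :=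
  q * (1 - q `^ (n%:R - 2 + lambda1 p + alpha1 p))
    * (1 - q `^ (n%:R - 2 + lambda1 p + alpha2 p)).

Lemma horner_c0 q x : (qheun_c p q 0).[x] = 1.
Proof. by rewrite qheun_c0 hornerC. Qed.

Lemma horner_c1 q x :
  (qheun_c p q 1).[x] = (qheun_den p q 1)^-1 * mid_coef q 1 x.
Proof.
rewrite /qheun_c [LHS]/= /qheun_rhs scaler0 subr0 mul1r.
by rewrite hornerZ hornerD hornerZ hornerX hornerC [_ * x]mulrC.
Qed.

Lemma horner_cSS q n x : (qheun_c p q n.+2).[x] = (qheun_den p q n.+2)^-1 *
  ((qheun_c p q n.+1).[x] * mid_coef q n.+2 x
   - low_coef q n.+2 * (qheun_c p q n).[x]).
Proof.
rewrite /qheun_c [X in X.[x] = _]/= /qheun_rhs.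
rewrite hornerZ hornerD hornerN hornerM hornerD !hornerZ hornerX hornerC.
by rewrite [_ * x]mulrC.
Qed.

Lemma size_c q n : (size (qheun_c p q n) <= n.+1)%N.
Proof.
suff : (size (qheun_c p q n) <= n.+1)%N /\ (size (qheun_c p q n.+1) <= n.+2)%N.
  by case.
have size_step m (u v : {poly R}) : (size v <= m.+1)%N -> (size u <= m.+1)%N ->
    (size ((qheun_den p q m.+1)^-1 *: qheun_rhs p q m.+1 u v)%R <= m.+2)%N.
  move=> sv su; apply: leq_trans (size_scale_leq _ _) _.
  apply: leq_trans (size_polyD _ _) _; rewrite size_polyN geq_max; apply/andP; split.
    apply: leq_trans (size_polyMleq _ _) _.
    set lin := (_ + _ : {poly R}).
    have : (size lin <= 2)%N.
      apply: leq_trans (size_polyD _ _) _; rewrite geq_max.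
      rewrite (leq_trans (size_scale_leq _ _)) ?size_polyX //.
      exact: leq_trans (size_polyC_leq1 _) _.
    by move: sv; move: (size _) (size _) => a b; lia.
  by apply: leq_trans (size_scale_leq _ _) _; apply: leq_trans su _.
elim: n => [|n [IH1 IH2]]; split=> //.
- by rewrite qheun_c0 size_poly1.
- by rewrite /qheun_c; apply: size_step; rewrite /= ?size_poly1 ?size_poly0.
- by rewrite /qheun_c; apply: size_step => //=; apply: leq_trans IH1 _.
Qed.

Lemma den_neq0 q n : 0 < t1 p -> 0 < t2 p -> beta p < 1 -> 0 < q < 1 ->
  qheun_den p q n.+1 != 0.
Proof.
move=> t10 t20 b1 /andP[q0 q1]; rewrite /qheun_den !mulf_neq0 ?lt0r_neq0 ?powR_gt0 //.
  by rewrite subr_gt0 exprn_ilt1 // ltW.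
have n1 : 0 < n.+1%:R - beta p.
  by rewrite subr_gt0 (lt_le_trans b1) // ler1n.
have := @gt0_ltr_powR R _ n1 q 1; rewrite powR1 subr_gt0 !nnegrE.
by apply=> //; exact: ltW.
Qed.

Lemma continuous_c n (E : R -> R) q : 0 < t1 p -> 0 < t2 p -> beta p < 1 ->
  0 < q < 1 -> {for q, continuous E} ->
  {for q, continuous (fun r => (qheun_c p r n).[E r])}.
Proof.
move=> t10 t20 b1 qI cE; have /andP[q0 _] := qI.
have cpow e : (fun r : R => r `^ e) @ q --> q `^ e by exact: continuous_powR.
have cden m : qheun_den p ^~ m.+1 @ q --> qheun_den p q m.+1.
  apply: cvgM; last by apply: cvgB; [exact: cvg_cst|exact: cpow].
  apply: cvgM; last by apply: cvgB; [exact: cvg_cst|exact: exprn_continuous].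
  by apply: cvgMl_tmp; exact: cpow.
have cmid m : (fun r => mid_coef r m (E r)) @ q --> mid_coef q m (E q).
  apply: cvgD; first by apply: cvgM => //; exact: cpow.
  apply: cvgD; apply: cvgM; try exact: cpow.
    by apply: cvgD; apply: cvgMr_tmp; exact: cpow.
  by apply: cvgD; apply: cvgMr_tmp; exact: cpow.
have clow m : low_coef ^~ m @ q --> low_coef q m.
  apply: cvgM; last by apply: cvgB; [exact: cvg_cst|exact: cpow].
  by apply: cvgM; [exact: cvg_id|apply: cvgB; [exact: cvg_cst|exact: cpow]].
have cinv m : (fun r => (qheun_den p r m.+1)^-1) @ q --> (qheun_den p q m.+1)^-1.
  by apply: cvgV => //; exact: den_neq0.
suff : {for q, continuous (fun r => (qheun_c p r n).[E r])} /\
       {for q, continuous (fun r => (qheun_c p r n.+1).[E r])} by case.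
elim: n => [|n [IH1 IH2]]; split=> //.
- have -> : (fun r => (qheun_c p r 0).[E r]) = (fun=> 1).
    by apply/funext => r; rewrite horner_c0.
  exact: cvg_cst.
- have -> : (fun r => (qheun_c p r 1).[E r]) =
      (fun r => (qheun_den p r 1)^-1 * mid_coef r 1 (E r)).
    by apply/funext => r; rewrite horner_c1.
  exact: cvgM.
- have -> : (fun r => (qheun_c p r n.+2).[E r]) = (fun r => (qheun_den p r n.+2)^-1 *
      ((qheun_c p r n.+1).[E r] * mid_coef r n.+2 (E r)
       - low_coef r n.+2 * (qheun_c p r n).[E r])).
    by apply/funext => r; rewrite horner_cSS.
  by apply: cvgM => //; apply: cvgB; apply: cvgM.
Qed.

End Recurrence.

Record admissible (R : realType) (p : qheun_params R) (N : nat) : Prop :=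
  Admissible {
    adm_N : N%:R = - lambda1 p - alpha1 p :> R;
    adm_beta : beta p < 1;
    adm_alpha : alpha2 p - alpha1 p < 1;
    adm_t1 : 0 < t1 p;
    adm_t2 : 0 < t2 p;
    adm_h : h1 p < h2 p;
    adm_l : l1 p < l2 p;
    adm_h2 : 2 * N%:R + 1 + h2 p - l2 p - beta p < 0;
    adm_l2 : 2 * N%:R + l1 p - l2 p - beta p < 0 }.

Section RecurrenceAsymptotics.
Variables (R : realType) (p : qheun_params R) (N : nat).
Hypothesis adm : admissible p N.

Lemma lambda1E : 2 * lambda1 p =
  h1 p + h2 p - l1 p - l2 p - alpha1 p - alpha2 p - beta p + 2.
Proof. by rewrite /lambda1; field. Qed.

Lemma asympt_1B e : 0 < e -> asympt (fun q : R => 1 - q `^ e) 1 0.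
Proof.
move=> e0; have := asymptB (asympt_cst 1) (asympt_o e0 (asympt_powR e)).
by rewrite subr0.
Qed.

Lemma asympt_1B_neg e : e < 0 -> asympt (fun q : R => 1 - q `^ e) (- 1) e.
Proof.
move=> e0; have := asymptB (asympt_o e0 (asympt_cst 1)) (asympt_powR e).
by rewrite sub0r.
Qed.

Lemma den_asympt n :
  asympt (qheun_den p ^~ n.+1) (t1 p * t2 p) (h1 p + h2 p).
Proof.
have [hN hbeta halpha ht1 ht2 hh hl hN1 hN2] := adm.
have n1 : 0 < n.+1%:R - beta p.
  by rewrite subr_gt0 (lt_le_trans hbeta) // ler1n.
have n0 : 0 < n.+1%:R :> R by rewrite ltr0n.
have := asymptM (asymptM (monomial_asympt (t1 p * t2 p) (h1 p + h2 p))
  (asympt_1B n0)) (asympt_1B n1).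
rewrite !mulr1 !addr0; apply: asympt_near; near=> q.
have q0 : 0 < q by near: q; exact: near0_gt0.
by rewrite /qheun_den powR_mulrn // ltW.
Unshelve. all: by end_near. Qed.

(** Both exponents of q inside the parentheses are negative: this is where
    alpha2 - alpha1 < 1 enters, and it is what breaks down at n = N+2. *)
Lemma low_asympt n : (n.+1 <= N)%N ->
  asympt (low_coef p ^~ n.+2) 1 (2 * n%:R + 3 + h1 p + h2 p - l1 p - l2 p - beta p).
Proof.
have [hN hbeta halpha ht1 ht2 hh hl hN1 hN2] := adm.
rewrite -(ler_nat R) -(natr1 n) => nN; have lam := lambda1E.
have nS : n.+2%:R = n%:R + 2 :> R by rewrite -addn2 natrD.
have e1 : n.+2%:R - 2 + lambda1 p + alpha1 p < 0.
  by rewrite nS; lra.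
have e2 : n.+2%:R - 2 + lambda1 p + alpha2 p < 0.
  by rewrite nS; lra.
have := asymptM (asymptM (asympt_powR 1) (asympt_1B_neg e1)) (asympt_1B_neg e2).
rewrite mul1r mulrNN mulr1 => low.
apply: asympt_near (asympt_eq (erefl _) _ low).
  near=> q; have q0 : 0 < q by near: q; exact: near0_gt0.
  by rewrite /low_coef powRr1 // ltW.
by rewrite nS; lra.
Unshelve. all: by end_near. Qed.

Section Energy.
Variables (k : nat) (E : R -> R) (s : R).
Hypothesis hk : (1 <= k <= N.+1)%N.
Hypothesis E_lead : asympt E (- (s * t1 p))
  (k%:R - 3 / 2 + lambda1 p + l1 p + alpha1 p + alpha2 p).

(** In the forward regime c_n / c_(n-1) is equivalent to
    (forward_coef n / t2) q^(forward_exp n).  The two indicators correspond to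
    the two competing terms of b_n, which are of the same order exactly when
    n = k. *)
Definition forward_coef n : R := (n <= k)%N%:R - s * (k <= n)%N%:R.
Definition forward_exp n : R := n%:R + (minn n k)%:R - 1 / 2 - l2 p - beta p.

Lemma mid_asympt n : (n <= N)%N ->
  asympt (fun q => mid_coef p q n.+1 (E q)) (t1 p * forward_coef n.+1)
    (forward_exp n.+1 + h1 p + h2 p).
Proof.
have [hN hbeta halpha ht1 ht2 hh hl hN1 hN2] := adm.
have k_le : (k <= N.+1)%N by case/andP: hk.
move=> nN; have nN' : n.+1%:R <= N%:R + 1 :> R by rewrite natr1 ler_nat.
have kN' : k%:R <= N%:R + 1 :> R.
  by rewrite natr1 ler_nat.
have mn : (minn n.+1 k)%:R <= n.+1%:R :> R by rewrite ler_nat geq_minl.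
have mk : (minn n.+1 k)%:R <= k%:R :> R by rewrite ler_nat geq_minr.
have lam := lambda1E.
pose x := forward_exp n.+1 + h1 p + h2 p.
(* Each summand of mid_coef is either of order exactly q^x or negligible,
   according to a boolean that becomes its coefficient. *)
have weak (f : R -> R) C e (b : bool) : (if b then e == x else x < e) -> asympt f C e ->
    asympt f (C * b%:R) x.
  case: b => [/eqP <-|xe] /=; first by rewrite mulr1.
  by rewrite mulr0; exact: asympt_o.
have termE : asympt (fun q => E q * q `^ (n.+1%:R - 1 + lambda1 p))
    (- (s * t1 p) * (k <= n.+1)%N%:R) x.
  apply: weak (asympt_eq (mulr1 _) (erefl _) (asymptM E_lead (asympt_powR _))).
  rewrite /x /forward_exp; case: leqP => kn.
    by apply/eqP; lra.
  by move: kn; rewrite -(ltr_nat R) => kn; lra.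
have termh e C : h1 p <= e ->
    asympt (fun q : R => q `^ (1 / 2) * (q `^ e * C)) 0 x.
  move=> he; have := asymptM (asympt_powR (1 / 2)) (monomial_asympt C e).
  rewrite mul1r => He; apply: asympt_near (asympt_o _ He).
    by apply: nearW => q; rewrite [C * _]mulrC.
  rewrite /x /forward_exp.
  lra.
have terml e C (b : bool) : (if b then e = l1 p /\ (n.+1 <= k)%N
      else ((k < n.+1)%N || (l1 p < e)) && (l1 p <= e)) ->
    asympt (fun q : R => q `^ e * C
      * q `^ (2 * (n.+1%:R - 1 + lambda1 p) + alpha1 p + alpha2 p - 1 / 2)) (C * b%:R) x.
  move=> be.
  have H := asymptM (monomial_asympt C e)
   (asympt_powR (2 * (n.+1%:R - 1 + lambda1 p) + alpha1 p + alpha2 p - 1 / 2)).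
  rewrite mulr1 in H; apply: weak (asympt_near _ H).
    rewrite /x /forward_exp; case: b be => [[-> nk]|/andP[/orP[kn|le1] le2]].
    - by rewrite (minn_idPl nk); apply/eqP; lra.
    - have := kn; rewrite -(ltr_nat R) => kn'.
      by rewrite (minn_idPr (ltnW kn)); lra.
    - lra.
  by apply: nearW => q; rewrite [C * _]mulrC.
have l1b : if (n.+1 <= k)%N then l1 p = l1 p /\ (n.+1 <= k)%N
    else ((k < n.+1)%N || (l1 p < l1 p)) && (l1 p <= l1 p).
  by case: leqP => [kn|_]; [rewrite ltnS kn lexx|split].
have l2b : ((k < n.+1)%N || (l1 p < l2 p)) && (l1 p <= l2 p).
  by rewrite hl orbT ltW.
have H := asymptD termE (asymptD
  (asymptD (termh _ (t1 p) (lexx _)) (termh _ (t2 p) (ltW hh)))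
  (asymptD (terml (l1 p) (t1 p) _ l1b) (terml (l2 p) (t2 p) false l2b))).
apply: asympt_near (asympt_eq _ (erefl x) H).
  by apply: nearW => q; rewrite /mid_coef; ring.
rewrite /forward_coef /=; ring.
Qed.

(** In the step, c_n contributes at an exponent larger than that of the c_(n+1)
    term by l2 - l1 + beta + 1 - min(n+1, k) - min(n+2, k), positive for
    n + 2 <= N + 1. No division by a ratio is involved, so
    vanishing constants (s = 1, n >= k) are harmless. *)
Lemma c_asympt n : (n <= N.+1)%N ->
  asympt (fun q => (qheun_c p q n).[E q])
    (\prod_(i < n) (forward_coef i.+1 / t2 p)) (\sum_(i < n) forward_exp i.+1).
Proof.
have [hN hbeta halpha ht1 ht2 hh hl hN1 hN2] := adm.
have t120 : t1 p * t2 p != 0 by rewrite mulf_neq0 ?lt0r_neq0.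
have t20 : t2 p != 0 by rewrite lt0r_neq0.
have lam := lambda1E; pose K m := \prod_(i < m) (forward_coef i.+1 / t2 p).
have KS m : (t1 p * t2 p)^-1 * (K m * (t1 p * forward_coef m.+1)) = K m.+1.
  by rewrite /K big_ord_recr /=; field; rewrite t20 lt0r_neq0.
pose X m := \sum_(i < m) forward_exp i.+1.
have XS m : - (h1 p + h2 p) + (X m + (forward_exp m.+1 + h1 p + h2 p)) = X m.+1.
  by rewrite /X big_ord_recr /=; ring.
have base : asympt (fun q => (qheun_c p q 0).[E q]) (K 0%N) (X 0%N).
  rewrite /K /X !big_ord0; apply: asympt_near (asympt_cst 1).
  by apply: nearW => q; rewrite horner_c0.
suff H m : (m <= N)%N -> asympt (fun q => (qheun_c p q m).[E q]) (K m) (X m) /\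
     asympt (fun q => (qheun_c p q m.+1).[E q]) (K m.+1) (X m.+1).
  case: n => [_|n nN]; first exact: base.
  by case: (H n nN).
elim: m => [_|m IH mN].
  split=> //; rewrite -KS -XS.
  have := asymptM (asymptV t120 (den_asympt 0)) (asymptM base (mid_asympt (leq0n N))).
  by apply: asympt_near; apply: nearW => q; rewrite horner_c0 mul1r horner_c1.
have [IH1 IH2] := IH (ltnW mN); split=> //.
rewrite -KS -XS -[K m.+1 * _]subr0.
have main := asymptM IH2 (mid_asympt mN).
have lower := asymptM (low_asympt mN) IH1.
have := asymptM (asymptV t120 (den_asympt m.+1)) (asymptB main (asympt_o _ lower)).
move=> H; apply: asympt_near (H _); first by apply: nearW => q; rewrite horner_cSS.
have -> : X m.+1 = X m + forward_exp m.+1 by rewrite /X big_ord_recr.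
rewrite /forward_exp.
have m1 : (minn m.+1 k)%:R <= m.+1%:R :> R by rewrite ler_nat geq_minl.
have m2 : (minn m.+2 k)%:R <= m.+2%:R :> R by rewrite ler_nat geq_minl.
have mS : m.+2%:R = m%:R + 2 :> R by rewrite -addn2 natrD.
move: mN; rewrite -(ler_nat R) -(natr1 m) => mN.
by rewrite -(natr1 m) mS in m1 m2 *; lra.
Qed.

End Energy.
End RecurrenceAsymptotics.

(** * Eigenvalues and recessive solutions *)

Section Eigen.
Variables (R : realType) (p : qheun_params R) (N : nat).
Hypothesis adm : admissible p N.

Definition eigen_exp k : R :=
  k%:R - 3 / 2 + lambda1 p + l1 p + alpha1 p + alpha2 p.
Definition eigen_scale k q : R := - q `^ eigen_exp k * t1 p.

Lemma eigen_scale_asympt k s :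
  asympt (fun q => eigen_scale k q * s) (- (s * t1 p)) (eigen_exp k).
Proof.
apply: asympt_near (monomial_asympt (- (s * t1 p)) (eigen_exp k)).
by apply: nearW => q; rewrite /eigen_scale; ring.
Qed.

(** Up to t2^-2, the i-th factor of the product of the two leading constants
    is 1 for i < k, s * t for i > k, and (1 - s) * (1 - t) < 0 for i = k. *)
Lemma eigen_sign k s t : (1 <= k <= N.+1)%N -> 0 < s < 1 -> 1 < t ->
  \forall q \near 0^'+, (qheun_c p q N.+1).[eigen_scale k q * s] *
                        (qheun_c p q N.+1).[eigen_scale k q * t] < 0.
Proof.
have [_ _ _ ht1 ht2 _ _ _ _] := adm.
move=> hk /andP[s0 s1] t1.
have value r := c_asympt adm hk (eigen_scale_asympt k r) (leqnn N.+1).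
apply: asympt_lt0 (asymptM (value s) (value t)).
rewrite -big_split /=; case: k hk {value} => // k /= kN.
rewrite (bigD1 (Ordinal (kN : (k < N.+1)%N))) //=.
have t20 := invr_gt0 (t2 p); rewrite ht2 in t20.
rewrite pmulr_llt0.
  by rewrite mulrACA (pmulr_llt0 _ (mulr_gt0 t20 t20)) /forward_coef leqnn !mulr1 /=; nra.
apply: prodr_gt0 => i; rewrite -val_eqE /= => ik; rewrite mulrACA.
apply: mulr_gt0; last by rewrite mulr_gt0.
rewrite /forward_coef !ltnS.
by case: (ltngtP i k) ik => // _ _; rewrite /= ?mulr0 ?mulr1; nra.
Qed.

(** All N+1 scales are needed at once: uniqueness near the k-th one comes from
    counting the roots near all of them. *)
Lemma eigen_roots k : (1 <= k <= N.+1)%N -> exists (q0 : R) (s : R -> R),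
  [/\ 0 < q0,
      forall q, 0 < q < q0 -> root (qheun_c p q N.+1) (eigen_scale k q * s q)
        /\ {for q, continuous s},
      s q @[q --> 0^'+] --> (1 : R) &
      forall E : R -> R, (\forall q \near 0^'+, root (qheun_c p q N.+1) (E q)) ->
        equiv0 E (eigen_scale k) ->
        \forall q \near 0^'+, E q = eigen_scale k q * s q].
Proof.
have [_ hbeta _ ht1 ht2 _ _ _ _] := adm.
case: k => // k /= kN.
apply: (@root_branch R N.+1 (qheun_c p ^~ N.+1) (fun i => eigen_scale i.+1)) => //.
- by apply: nearW => q; exact: size_c.
- have sep i j : (i < j)%N ->
      \forall q \near 0^'+, `|eigen_scale j.+1 q| * 3 < `|eigen_scale i.+1 q|.
    move=> ij; have ee : eigen_exp i.+1 < eigen_exp j.+1.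
      by rewrite /eigen_exp !ltrD2r ltr_nat ltnS.
    have t1N : - t1 p != 0 by rewrite oppr_eq0 lt0r_neq0.
    apply: filterS (monomial_separated (- t1 p) t1N ee) => q.
    by rewrite /eigen_scale !mulNr ![t1 p * _]mulrC.
  move=> i j _ _; rewrite neq_ltn => /orP[] /sep; apply: filterS => q; tauto.
- by move=> i s t iN; exact: eigen_sign.
- move=> i iN; near=> q => x.
  have qI : 0 < q < 1 by near: q; exact: near0_lt1.
  apply: (@continuous_c R p N.+1 (fun q => eigen_scale i.+1 q * x)) => //.
  apply: cvgMr_tmp; apply: cvgMr_tmp; apply: cvgN; apply: continuous_powR.
  by case/andP: qI.
Unshelve. all: by end_near. Qed.

End Eigen.

Section Eigenfunction.
Variables (R : realType) (p : qheun_params R) (N k : nat) (E : R -> R).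
Hypothesis adm : admissible p N.
Hypothesis hk : (1 <= k <= N.+1)%N.
Hypothesis E_root : \forall q \near 0^'+, root (qheun_c p q N.+1) (E q).
Hypothesis E_equiv : equiv0 E (eigen_scale p k).

Lemma eigen_asympt : asympt E (- (1 * t1 p)) (eigen_exp p k).
Proof.
have [_ _ _ ht1 _ _ _ _ _] := adm.
have t10 : - (1 * t1 p) != 0 by rewrite mul1r oppr_eq0 lt0r_neq0.
apply: (equiv0_asympt t10 E_equiv).
by apply: asympt_near (eigen_scale_asympt p k 1); apply: nearW => q; rewrite mulr1.
Qed.

(** An arbitrary root function equivalent to the k-th scale coincides near 0+
    with the continuous branch of roots. *)
Lemma continuous_eigenvalue : \forall q \near 0^'+, {for q, continuous E}.
Proof.
have [q0 [s [q00 Hs _ Euniq]]] := eigen_roots adm hk.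
have [q1 q10 EE] := near0_exists (Euniq E E_root E_equiv).
have qm : 0 < Num.min q0 q1 by rewrite lt_min q00.
near=> q.
have qgt : 0 < q by near: q; exact: near0_gt0.
have qlt : q < Num.min q0 q1 by near: q; exact: nbhs_right_lt.
move: qlt; rewrite lt_min => /andP[qq0 qq1].
have qI : 0 < q < q0 by rewrite qgt.
have [_ cs] := Hs q qI.
have cw : (fun r => eigen_scale p k r * s r) @ q --> eigen_scale p k q * s q.
  apply: cvgM cs; apply: cvgMr_tmp; apply: cvgN; exact: continuous_powR.
rewrite /prop_for /continuous_at EE ?qgt //; apply: cvg_trans cw.
apply: near_eq_cvg; near=> r; rewrite EE //; near: r; apply: near_itv.
by rewrite qgt.
Unshelve. all: by end_near. Qed.

(** c_n / c_(n-1) is equivalent to ratio_coef n * q^(ratio_exp n) at E = E_k. *)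
Definition ratio_exp n : R :=
  if (n < k)%N then 2 * n%:R - 1 / 2 - l2 p - beta p
  else n%:R - k%:R + 1 / 2 - l1 p.
Definition ratio_coef n : R := if (n < k)%N then (t2 p)^-1 else - (t1 p)^-1.

(** The exponent increases by 2 before k and by 1 after it; the jump at k is
    positive because of the inequality on l1 - l2. *)
Lemma ratio_exp_incr i j : (i < j <= N)%N -> ratio_exp i < ratio_exp j.
Proof.
have [_ _ _ _ _ _ _ _ hl2] := adm; case/andP: hk => _.
rewrite -(ler_nat R) -natr1 => kN /andP[ij jN].
have := ij; rewrite -(ltr_nat R) => ij'; move: jN; rewrite -(ler_nat R) => jN.
rewrite /ratio_exp; case: ltnP => ik; case: ltnP => jk.
- by lra.
- by move: ik jk; rewrite -(ler_nat R) -natr1 -(ler_nat R); lra.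
- by have := leq_ltn_trans ik (ltn_trans ij jk); rewrite ltnn.
- by lra.
Qed.

Lemma ratio_coef_neq0 n : ratio_coef n != 0.
Proof.
have [_ _ _ ht1 ht2 _ _ _ _] := adm.
by rewrite /ratio_coef; case: ifP => _; rewrite ?oppr_eq0 invr_eq0 lt0r_neq0.
Qed.

(** Eliminating c_(n+2) leaves (b_(n+2) - D_(n+2) rho) c_(n+1) = a_(n+2) c_n,
    and D_(n+2) rho is negligible whatever the constant C is; in particular
    C = 0 starts the descent at c_(N+1) = 0. *)
Lemma backward_step n (C : R) (rho : R -> R) : (k <= n.+1 <= N)%N ->
  (\forall q \near 0^'+,
     (qheun_c p q n.+2).[E q] = rho q * (qheun_c p q n.+1).[E q]) ->
  asympt rho C (ratio_exp n.+2) ->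
  exists2 rho' : R -> R, asympt rho' (- (t1 p)^-1) (ratio_exp n.+1) &
  \forall q \near 0^'+,
     (qheun_c p q n.+1).[E q] = rho' q * (qheun_c p q n).[E q].
Proof.
have [hN hbeta halpha ht1 ht2 hh hl hN1 hN2] := adm.
move=> /andP[kn nN] crho rhoC; have lam := lambda1E p.
have mid := mid_asympt adm hk eigen_asympt nN.
have low := low_asympt adm nN.
have den := asymptM (den_asympt adm n.+1) rhoC.
have kn' : k%:R <= n%:R + 1 :> R by rewrite natr1 ler_nat.
have nN' : n%:R + 1 <= N%:R :> R by rewrite natr1 ler_nat.
have n2 : n.+2%:R = n%:R + 2 :> R by rewrite -addn2 natrD.
have kmin : minn n.+2 k = k by apply/minn_idPr; apply: leq_trans kn _.
have ellE : t1 p * forward_coef k 1 n.+2 - 0 = - t1 p.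
  by rewrite /forward_coef (leqW kn) leqNgt ltnS kn /= ; ring.
have weak : forward_exp p k n.+2 + h1 p + h2 p < h1 p + h2 p + ratio_exp n.+2.
  by rewrite /forward_exp /ratio_exp kmin ltnNge (leqW kn) /= n2; lra.
have piv := asymptB mid (asympt_o weak den); rewrite ellE in piv.
have t10 : - t1 p != 0 by rewrite oppr_eq0 lt0r_neq0.
exists (fun q => low_coef p q n.+2 *
  (mid_coef p q n.+2 (E q) - qheun_den p q n.+2 * rho q)^-1).
  apply: asympt_eq (asymptM low (asymptV t10 piv)).
    by rewrite mul1r invrN.
  rewrite /forward_exp /ratio_exp kmin ltnNge kn /= n2 -(natr1 n); lra.
near=> q; have qI : 0 < q < 1 by near: q; exact: near0_lt1.
have pivq : mid_coef p q n.+2 (E q) - qheun_den p q n.+2 * rho q != 0.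
  by near: q; exact: asympt_neq0 piv.
have : (qheun_c p q n.+2).[E q] = rho q * (qheun_c p q n.+1).[E q] by near: q.
rewrite horner_cSS => /(congr1 ( *%R (qheun_den p q n.+2))).
rewrite mulVKf ?den_neq0 // => rec.
apply: (mulIf pivq); rewrite [RHS]mulrAC mulfVK // mulrBr.
by lra.
Unshelve. all: by end_near. Qed.

Lemma backward_ratio n : (k <= n.+1 <= N)%N ->
  exists2 rho : R -> R, asympt rho (- (t1 p)^-1) (ratio_exp n.+1) &
  \forall q \near 0^'+,
     (qheun_c p q n.+1).[E q] = rho q * (qheun_c p q n).[E q].
Proof.
move=> /andP[kn nN]; move Ed : (N - n.+1)%N => d.
elim: d n kn nN Ed => [|d IH] n kn nN Ed.
  have nE : n.+1 = N by apply/eqP; rewrite eqn_leq nN -subn_eq0 Ed.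
  apply: (@backward_step n 0 (fun=> 0)); rewrite ?kn //.
    apply: filterS E_root => q /rootP; by rewrite nE mul0r.
  by apply: asympt_near (monomial_asympt 0 _); apply: nearW => q; rewrite mul0r.
have nN2 : (n.+2 <= N)%N by lia.
have [||rho rhoC crho] := IH n.+1 _ nN2; first exact: leqW.
  by lia.
by apply: backward_step crho rhoC; rewrite kn.
Qed.

Lemma coef_asympt n : (n <= N)%N -> asympt (fun q => (qheun_c p q n).[E q])
  (\prod_(i < n) ratio_coef i.+1) (\sum_(i < n) ratio_exp i.+1).
Proof.
elim: n => [_|n IH nN].
  rewrite !big_ord0; apply: asympt_near (asympt_cst 1).
  by apply: nearW => q; rewrite horner_c0.
have [nk|kn] := ltnP n.+1 k.
  have := c_asympt adm hk eigen_asympt (leqW nN); apply: asympt_eq.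
    apply: eq_bigr => i _; have ik := leq_ltn_trans (ltn_ord i) nk.
    by rewrite /ratio_coef ik /forward_coef (ltnW ik) leqNgt ik /= mulr0 subr0 mul1r.
  apply: eq_bigr => i _; have ik := leq_ltn_trans (ltn_ord i) nk.
  rewrite /ratio_exp ik /forward_exp (minn_idPl (ltnW ik)); ring.
have [|rho rhoC crho] := @backward_ratio n; first by rewrite kn.
rewrite !big_ord_recr /= {2}/ratio_coef {2}/ratio_exp ltnNge kn /=.
have := asymptM (IH (ltnW nN)) rhoC; rewrite /ratio_exp ltnNge kn /=.
by apply: asympt_near; apply: filterS crho => q ->; rewrite mulrC.
Qed.

End Eigenfunction.

(** * The q-Heun equation *)

(** The rec hypotheses say that the coefficient of each x^n vanishes; only the
    boundary terms at the top survive, and rewriting two of them through rec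
    avoids a separate case for m = 0. *)
Lemma three_term_telescope (R : comRingType) (c F G H : nat -> R) (x : R) :
  F 0%N = 0 -> c 1%N * F 1%N + c 0%N * G 0%N = 0 ->
  (forall n, c n.+2 * F n.+2 + c n.+1 * G n.+1 + c n * H n = 0) ->
  forall m, \sum_(n < m.+1) c n * x ^+ n * (F n + G n * x + H n * x ^+ 2) =
    x ^+ m.+1 * (c m * H m * x - c m.+1 * F m.+1).
Proof.
move=> F0 rec0 rec; elim=> [|m IH].
  by rewrite big_ord1 F0; have := canRL (addrK _) rec0; rewrite sub0r => ->; ring.
rewrite big_ord_recr /= IH.
have -> : c m.+2 * F m.+2 = - (c m.+1 * G m.+1 + c m * H m).
  by apply/eqP; rewrite -addr_eq0 addrA rec.
by rewrite !exprS; ring.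
Qed.

Section Equation.
Variables (R : realType) (p : qheun_params R) (N : nat) (q E : R).
Hypothesis adm : admissible p N.
Hypothesis q01 : 0 < q < 1.
Hypothesis E_root : root (qheun_c p q N.+1) E.

(** Substituting x^lambda1 * sum c_n x^n, the n-th term produces
    c_n x^n (F_n + G_n x + H_n x^2).  With u_n = q^(lambda1 + n) one has
    F_n u_n = q D_n, G_n u_n = - b_(n+1) and q H_n u_n = a_(n+2), so the
    vanishing of the coefficients is the recurrence divided by u_(n-1), and
    F_0 = H_N = 0 by the choice of lambda1 and N. *)
Lemma qheun_eq_eigenfunction x : 0 < x ->
  qheun_eq p q E (fun y => y `^ lambda1 p * (qheun_poly p N q E).[y]) x.
Proof.
have [hN hbeta _ ht1 ht2 _ _ _ _] := adm; have /andP[q0 q1] := q01.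
move=> x0; have lam := lambda1E p; have q_neq0 := lt0r_neq0 q0.
have powD a b : q `^ a * q `^ b = q `^ (a + b) by rewrite gt0_powRD.
have powX n : q ^+ n = q `^ n%:R by rewrite powR_mulrn // ltW.
pose u n := q `^ (lambda1 p + n%:R).
have u0 n : u n != 0 by rewrite lt0r_neq0 // powR_gt0.
have uS n : u n.+1 = q * u n.
  by rewrite -[X in X * u n]powRr1 ?ltW // powD /u -natr1; congr (q `^ _); ring.
pose A := q `^ (h1 p + 1 / 2) * t1 p; pose B := q `^ (h2 p + 1 / 2) * t2 p.
pose C := q `^ (l1 p - 1 / 2) * t1 p; pose D := q `^ (l2 p - 1 / 2) * t2 p.
pose a12 := q `^ (alpha1 p + alpha2 p).
pose M := q `^ ((h1 p + h2 p + l1 p + l2 p + alpha1 p + alpha2 p) / 2)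
  * (q `^ (beta p / 2) + q `^ (- (beta p / 2))) * t1 p * t2 p.
pose F n := A * B / u n + a12 * C * D * u n - M.
pose G n := - (A + B) / u n - a12 * (C + D) * u n - E.
pose H n := (u n)^-1 + a12 * u n - (q `^ alpha1 p + q `^ alpha2 p).
have a12E : a12 = q `^ alpha1 p * q `^ alpha2 p by rewrite powD.
have Fden n : F n * u n = q * (t1 p * t2 p * q `^ (h1 p + h2 p)
    * (1 - q ^+ n) * (1 - q `^ (n%:R - beta p))).
  pose W := q `^ (h1 p + h2 p + 1); pose V := q `^ n%:R; pose T := q `^ (- beta p).
  have AB : A * B = W * (t1 p * t2 p).
    by rewrite /A /B mulrACA powD; congr (q `^ _ * _); lra.
  have CD : a12 * C * D * u n * u n = W * V * V * T * (t1 p * t2 p).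
    rewrite /C /D.
    have -> : q `^ (h1 p + h2 p + 1) * V * V * T =
        a12 * (q `^ (l1 p - 1 / 2) * q `^ (l2 p - 1 / 2)) * u n * u n.
      by rewrite !powD; congr (q `^ _); lra.
    ring.
  have Mu : M * u n = (W * V + W * V * T) * (t1 p * t2 p).
    have -> : W * V = q `^ ((h1 p + h2 p + l1 p + l2 p + alpha1 p + alpha2 p) / 2)
        * q `^ (beta p / 2) * u n.
      by rewrite !powD; congr (q `^ _); lra.
    have -> : q `^ ((h1 p + h2 p + l1 p + l2 p + alpha1 p + alpha2 p) / 2)
        * q `^ (beta p / 2) * u n * T =
        q `^ ((h1 p + h2 p + l1 p + l2 p + alpha1 p + alpha2 p) / 2)
        * q `^ (- (beta p / 2)) * u n.
      by rewrite !powD; congr (q `^ _); lra.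
    by rewrite /M; ring.
  transitivity (A * B + a12 * C * D * u n * u n - M * u n).
    by rewrite /F; field.
  have -> : q `^ (n%:R - beta p) = V * T by rewrite powD.
  have -> : q * (t1 p * t2 p * q `^ (h1 p + h2 p) * (1 - q ^+ n) * (1 - V * T)) =
      (q `^ (h1 p + h2 p) * q `^ 1) * (t1 p * t2 p * (1 - V) * (1 - V * T)).
    by rewrite powRr1 ?ltW // powX -/V; ring.
  by rewrite powD AB CD Mu -/W; ring.
have Gmid n : G n * u n = - mid_coef p q n.+1 E.
  have -> : mid_coef p q n.+1 E = A + B + a12 * (C + D) * u n * u n + E * u n.
    rewrite /mid_coef /A /B /C /D.
    have -> : n.+1%:R - 1 + lambda1 p = lambda1 p + n%:R by rewrite -natr1; ring.
    have -> : q `^ (2 * (lambda1 p + n%:R) + alpha1 p + alpha2 p - 1 / 2) =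
        a12 * u n * u n * q `^ (- (1 / 2)).
      by rewrite !powD; congr (q `^ _); ring.
    rewrite -/(u n) -!powD; ring.
  by rewrite /G; field.
have Hlow n : q * (H n * u n) = low_coef p q n.+2.
  have nE : n.+2%:R - 2 + lambda1 p = lambda1 p + n%:R by rewrite -addn2 natrD; ring.
  rewrite /low_coef nE -(powD _ (alpha1 p)) -(powD _ (alpha2 p)).
  by rewrite -/(u n) /H a12E; field.
have F0 : F 0%N = 0.
  by apply: (mulIf (u0 0%N)); rewrite Fden expr0 subrr !(mulr0, mul0r).
have Fden' n : F n.+1 * u n = qheun_den p q n.+1.
  by apply: (mulfI q_neq0); rewrite mulrCA -uS Fden.
pose c n := (qheun_c p q n).[E].
have rec0 : c 1%N * F 1%N + c 0%N * G 0%N = 0.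
  apply: (mulIf (u0 0%N)); rewrite mulrDl -!mulrA Fden' Gmid mul0r.
  by rewrite /c horner_c0 horner_c1 mulrC mulVKf ?den_neq0 // mul1r subrr.
have rec n : c n.+2 * F n.+2 + c n.+1 * G n.+1 + c n * H n = 0.
  apply: (mulIf (u0 n.+1)); rewrite !mulrDl -!mulrA Fden' Gmid mul0r.
  rewrite [H n * _]mulrC uS -mulrA [u n * _]mulrC Hlow.
  by rewrite /c horner_cSS mulrC mulVKf ?den_neq0 //; ring.
have HN : H N = 0.
  have uN : q `^ alpha1 p * u N = 1.
    by rewrite powD hN -(powRr0 q); congr (q `^ _); ring.
  apply: (mulIf (u0 N)); rewrite mul0r.
  have -> : H N * u N = (1 - q `^ alpha1 p * u N) * (1 - q `^ alpha2 p * u N).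
    by rewrite /H a12E; field.
  by rewrite uN subrr mul0r.
have cN : c N.+1 = 0 by apply/rootP.
have sum0 := three_term_telescope x F0 rec0 rec N.
rewrite HN cN !(mul0r, mulr0) subr0 mulr0 in sum0.
have hornerP y : (qheun_poly p N q E).[y] = \sum_(n < N.+1) c n * y ^+ n.
  by rewrite horner_poly.
have un (n : nat) : u n = u 0%N * q ^+ n by rewrite powX powD addr0.
have powx y : 0 < y -> (x * y) `^ lambda1 p = x `^ lambda1 p * y `^ lambda1 p.
  by move=> y0; rewrite powRM // ltW.
have qV : (q^-1) `^ lambda1 p = (u 0%N)^-1.
  by rewrite -powR_inv1 ?ltW // -powRrM mulN1r powRN /u addr0.
rewrite /qheun_eq powx ?invr_gt0 // [q * x]mulrC powx // qV.
rewrite !hornerP -/M -/a12 -/A -/B -/C -/D.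
have -> : q `^ lambda1 p = u 0%N by rewrite /u addr0.
transitivity (x `^ lambda1 p *
  \sum_(n < N.+1) c n * x ^+ n * (F n + G n * x + H n * x ^+ 2)); last first.
  by rewrite sum0 mulr0.
rewrite mulr_sumr !mulrA !mulr_sumr -big_split /= -sumrB.
apply: eq_bigr => n _; rewrite !exprMn exprVn /F /G /H (un n).
by field; rewrite u0 expf_neq0.
Qed.

End Equation.

(** * Asymptotics of the polynomial-type solutions *)

Theorem theorem4p6 (R : realType) (p : qheun_params R) (N k : nat) (Ek : R -> R)
  (hN : N%:R = - lambda1 p - alpha1 p)
  (hbeta : beta p < 1) (halpha : alpha2 p - alpha1 p < 1)
  (ht1 : 0 < t1 p) (ht2 : 0 < t2 p)
  (hh : h1 p < h2 p) (hl : l1 p < l2 p)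
  (hN1 : 2 * N%:R + 1 + h2 p - l2 p - beta p < 0)
  (hN2 : 2 * N%:R + l1 p - l2 p - beta p < 0)
  (hk : (1 <= k <= N.+1)%N)
  (hroot : \forall q \near 0^'+, root (qheun_c p q N.+1) (Ek q))
  (hEk : equiv0 Ek (fun q =>
     - q `^ (k%:R - 3 / 2 + lambda1 p + l1 p + alpha1 p + alpha2 p) * t1 p)) :
  (* (i) *)
  ((\forall q \near 0^'+, forall x : R, 0 < x ->
      qheun_eq p q (Ek q)
        (fun y => y `^ lambda1 p * (qheun_poly p N q (Ek q)).[y]) x) /\
   (forall n : nat, (1 <= n <= k.-1)%N ->
      equiv0 (fun q => (qheun_c p q n).[Ek q])
        (fun q => (t2 p)^-1 * q `^ (2 * n%:R - 1 / 2 - l2 p - beta p)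
                  * (qheun_c p q n.-1).[Ek q])) /\
   (forall n : nat, (k <= n <= N)%N ->
      equiv0 (fun q => (qheun_c p q n).[Ek q])
        (fun q => - (t1 p)^-1 * q `^ (n%:R - k%:R + 1 / 2 - l1 p)
                  * (qheun_c p q n.-1).[Ek q]))) /\
  (* (ii) *)
  poly_equiv0 N (fun q => qheun_poly p N q (Ek q))
    (fun q =>
       \prod_(1 <= j < k)
         (1 + ((t2 p)^-1 * q `^ (2 * j%:R - 1 / 2 - l2 p - beta p)) *: 'X)
       * \prod_(k <= j < N.+1)
         (1 - ((t1 p)^-1 * q `^ (j%:R - k%:R + 1 / 2 - l1 p)) *: 'X)) /\
  (* (iii) *)
  (forall j : nat, (1 <= j <= N)%N ->
     exists (qj : R) (xj : R -> R),
       [/\ 0 < qj,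
           forall q : R, 0 < q < qj ->
             root (qheun_poly p N q (Ek q)) (xj q) /\ {for q, continuous xj},
           (j <= k.-1)%N -> equiv0 xj
             (fun q => - t2 p * q `^ (- (2 * j%:R) + 1 / 2 + l2 p + beta p)) &
           (k <= j)%N -> equiv0 xj
             (fun q => t1 p * q `^ (k%:R - j%:R - 1 / 2 + l1 p))]).

Proof.
have adm : admissible p N by split.
have E_equiv : equiv0 Ek (eigen_scale p k) by [].
pose C i := ratio_coef p k i.+1; pose e i := ratio_exp p k i.+1.
have C0 i : (i < N)%N -> C i != 0 by move=> _; exact: ratio_coef_neq0 adm _.
have e_incr i j : (i < j < N)%N -> e i < e j.
  by move=> ij; apply: (ratio_exp_incr adm hk).
have lead n (nN : (n <= N)%N) := coef_asympt adm hk hroot E_equiv nN.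
have lead0 n (nN : (n <= N)%N) : \prod_(i < n) C i != 0 by exact: leading_neq0 C0 _ nN.
have ratio n : (n < N)%N -> equiv0 (fun q => (qheun_c p q n.+1).[Ek q])
    (fun q => C n * q `^ e n * (qheun_c p q n).[Ek q]).
  move=> nN; apply: asympt_equiv0 (lead0 _ nN) (lead _ nN) _.
  have := asymptM (monomial_asympt (C n) (e n)) (lead _ (ltnW nN)).
  by rewrite !big_ord_recr /= mulrC addrC.
split; [split; last split|split].
- near=> q; apply: (qheun_eq_eigenfunction adm); near: q => //.
  exact: near0_lt1.
- move=> [//|n] /= nk; have nk' : (n.+1 < k)%N by lia.
  have := ratio n; rewrite /C /e /ratio_coef /ratio_exp nk'; apply.
  by lia.
- move=> [|n] /andP[kn nN]; first by case: (k) hk kn.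
  by have := ratio n nN; rewrite /C /e /ratio_coef /ratio_exp ltnNge kn.
- have prodE q : \prod_(1 <= j < k)
         (1 + ((t2 p)^-1 * q `^ (2 * j%:R - 1 / 2 - l2 p - beta p)) *: 'X)
       * \prod_(k <= j < N.+1)
         (1 - ((t1 p)^-1 * q `^ (j%:R - k%:R + 1 / 2 - l1 p)) *: 'X) =
      \prod_(i < N) (1 + (C i * q `^ e i) *: 'X).
    transitivity (\prod_(1 <= j < N.+1)
        (1 + (ratio_coef p k j * q `^ ratio_exp p k j) *: 'X)); last first.
      by rewrite big_add1 big_mkord.
    case/andP: hk => k1 kN; rewrite [RHS](big_cat_nat k1 kN) /=; congr (_ * _).
      by apply: eq_big_nat => j /andP[j1 jk]; rewrite /ratio_coef /ratio_exp jk.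
    apply: eq_big_nat => j /andP[kj jN].
    by rewrite /ratio_coef /ratio_exp ltnNge kj /= mulNr scaleNr.
  split.
    apply: nearW => q; rewrite prodE; split; first exact: size_poly.
    exact: (size_prod_linear (fun i => C i * q `^ e i)).
  move=> i iN; apply: asympt_equiv0 (lead0 _ iN) _ _.
    apply: asympt_near (lead _ iN); apply: nearW => q.
    by rewrite coef_poly ltnS iN.
  apply: asympt_near (newton_product_coef C e_incr iN); apply: nearW => q.
  by rewrite prodE.
- case=> // j /andP[_ jN].
  have cont : \forall q \near 0^'+, forall n, (n <= N)%N ->
      {for q, continuous (fun r => (qheun_c p r n).[Ek r])}.
    near=> q => n _; apply: continuous_c => //; near: q; first exact: near0_lt1.
    exact: (continuous_eigenvalue adm hk hroot E_equiv).
  have [q0 [x [q00 Hx xw]]] := newton_roots C0 e_incr lead cont jN.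
  exists q0, x; split=> // [jk|kj].
    have jk' : (j.+1 < k)%N by lia.
    move: xw; congr (equiv0 _ _); apply/funext => q.
    rewrite /C /e /ratio_coef /ratio_exp jk' invrK; congr (_ * _ `^ _); ring.
  move: xw; congr (equiv0 _ _); apply/funext => q.
  rewrite /C /e /ratio_coef /ratio_exp ltnNge kj /= invrN opprK invrK.
  by congr (_ * _ `^ _); ring.
Unshelve. all: by end_near. Qed.
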